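(* Let $z_1=(x_1,y_1)$ and $z_2=(x_2,y_2)$ be distinct points of $\mathbb{Z}^2$ with $x_2-x_1\ge|y_2-y_1|$, so that $d^{\star}(z_1,z_2)=x_2-x_1$. Let $d\ge d^{\star}(z_1,z_2)$ be an integer, $c=d-d^{\star}(z_1,z_2)$, and let ${\cal A}^{\star}_d(z_1,z_2)$ be the optimal tristance anticode in ${\cal G}^{\star}_2$ of diameter $d$ centered about $z_1$ and $z_2$. Then ${\cal A}^{\star}_d(z_1,z_2)$ consists of all $(x,y)\in\mathbb{Z}^2$ such that $x_1-c\le x\le x_2+c$, $x_1+y_1-2c\le x+y\le x_2+y_2+2c$, $x_1-y_1-2c\le x-y\le x_2-y_2+2c$, $(x_1+y_1)-(x_2-y_2)-2c\le 2y\le (x_2+y_2)-(x_1-y_1)+2c$.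
   Context: The infinity graph ${\cal G}^{\star}_2$ has vertex set $\mathbb{Z}^2$, with $(x,y)$ and $(x',y')$ adjacent iff $d^{\star}((x,y),(x',y'))=\max\{|x-x'|,|y-y'|\}=1$. For $z_1,z_2,z_3\in\mathbb{Z}^2$, the tristance $d^{\star}_3(z_1,z_2,z_3)$ is the minimum number of edges of a tree in ${\cal G}^{\star}_2$ (possibly using additional vertices) containing $z_1,z_2,z_3$. A set ${\cal A}\subset\mathbb{Z}^2$ is a tristance anticode of diameter $d$ centered about $z_1,z_2$ if $d^{\star}_3(z_1,z_2,z)\le d$ for all $z\in{\cal A}$; it is optimal if it has largest possible cardinality among such sets. *)

(* Defs.v *)
From HB Require Import structures.
From mathcomp Require Import all_boot all_order all_algebra.
From mathcomp Require Import finmap zify.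
From mathcomp Require Import boolp classical_sets cardinality.

Set Implicit Arguments.
Unset Strict Implicit.
Unset Printing Implicit Defensive.

Import Order.TTheory GRing.Theory Num.Theory.

Local Open Scope fset_scope.
Local Open Scope ring_scope.

Section Trees.
Variables (T : choiceType) (adj : rel T).

(* An undirected edge is an unordered pair, encoded as a two-element set. *)
Definition edge_rel (E : {fset {fset T}}) : rel T :=
  fun u v => [fset u; v] \in E.

Definition is_subgraph (V : {fset T}) (E : {fset {fset T}}) : Prop :=
  forall e, e \in E ->
    exists u v, [/\ u \in V, v \in V, u != v, adj u v & e = [fset u; v]].

Definition is_connected (V : {fset T}) (E : {fset {fset T}}) : Prop :=
  forall u v, u \in V -> v \in V ->
    exists2 p, path (edge_rel E) u p & last u p = v.

(* edge_rel is symmetric, so [:: u; v] is a ucycle for every edge {u, v}: only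
   cycles through at least three vertices count. *)
Definition is_acyclic (E : {fset {fset T}}) : Prop :=
  forall c : seq T, (2 < size c)%N -> ~ ucycle (edge_rel E) c.

Definition is_tree (V : {fset T}) (E : {fset {fset T}}) : Prop :=
  [/\ V != fset0, is_subgraph V E, is_connected V E & is_acyclic E].

Definition joined_by_tree (z1 z2 z3 : T) (n : nat) : Prop :=
  exists V E, [/\ is_tree V E, [/\ z1 \in V, z2 \in V & z3 \in V]
                & #|` E| = n].

Lemma edge_relC E u v : edge_rel E u v = edge_rel E v u.
Proof. by rewrite /edge_rel fsetUC. Qed.

Lemma edge_rel_in V E u v :
  is_subgraph V E -> edge_rel E u v -> (u \in V) && (v \in V).
Proof.
move=> sub /sub [a [b [aV bV _ _ e]]].
have sV : [fset u; v] `<=` V.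
  by rewrite e; apply/fsubsetP => w /fset2P [] ->.
by apply/andP; split; apply: (fsubsetP sV); rewrite in_fset2 eqxx ?orbT.
Qed.

Lemma tree1 z : is_tree [fset z] fset0.
Proof.
split.
- by apply/fset0Pn; exists z; rewrite in_fset1.
- by move=> e; rewrite in_fset0.
- by move=> u v /fset1P -> /fset1P ->; exists [::].
- by case=> [|a [|b s]] //= _ /andP [/andP []]; rewrite /edge_rel in_fset0.
Qed.

Lemma tree_leaf V E u v : is_tree V E -> u \in V -> v \notin V -> adj u v ->
  is_tree (v |` V) ([fset u; v] |` E).
Proof.
move=> [V0 sub con acy] uV vV uv.
have uDv : u != v by apply: contraNneq vV => <-.
set E' := _ |` E.
have nbr w : edge_rel E' v w -> w = u.
  rewrite /edge_rel !inE => /orP [/eqP e|].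
    have : u \in [fset v; w] by rewrite e in_fset2 eqxx.
    by rewrite in_fset2 (negbTE uDv) => /eqP ->.
  by move/(edge_rel_in sub); rewrite (negbTE vV).
have old a b : a != v -> b != v -> edge_rel E' a b -> edge_rel E a b.
  move=> av bv; rewrite /edge_rel !inE => /orP [/eqP e|//].
  have : v \in [fset a; b] by rewrite e in_fset2 eqxx orbT.
  by rewrite in_fset2 eq_sym (negbTE av) eq_sym (negbTE bv).
have mon : subrel (edge_rel E) (edge_rel E').
  by move=> a b; rewrite /edge_rel !inE => ->; rewrite orbT.
have euv : edge_rel E' u v by rewrite /edge_rel !inE eqxx.
split.
- by apply/fset0Pn; exists v; rewrite !inE eqxx.
- move=> e /fset1UP [->|/sub [a [b [aV bV ab adjab ->]]]].
    by exists u, v; rewrite !inE eqxx uV orbT.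
  by exists a, b; rewrite !inE aV bV !orbT.
- have tou a : a \in v |` V -> exists2 p, path (edge_rel E') a p & last a p = u.
    move=> /fset1UP [->|aV].
      by exists [:: u] => //=; rewrite edge_relC euv.
    have [p pp <-] := con _ _ aV uV; exists p => //.
    exact: sub_path mon _ _ pp.
  have ofu a : a \in v |` V -> exists2 p, path (edge_rel E') u p & last u p = a.
    move=> /fset1UP [->|aV].
      by exists [:: v] => //=; rewrite euv.
    have [p pp <-] := con _ _ uV aV; exists p => //.
    exact: sub_path mon _ _ pp.
  move=> a b /tou [p pp lp] /ofu [q qq lq]; exists (p ++ q).
    by rewrite cat_path pp lp.
  by rewrite last_cat lp.
- move=> c c2 cyc; have [vc|vc] := boolP (v \in c); last first.
    apply: (acy c c2); case/andP: cyc => cyc uc; apply/andP; split=> //.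
    have allc : all (mem c) c by exact/allP.
    apply: sub_in_cycle allc cyc => a b; rewrite !inE => ac bc.
    by apply: old; apply: contraNneq vc => <-.
  have [i s es] := rot_to vc.
  have : ucycle (edge_rel E') (v :: s) by rewrite -es rot_ucycle.
  have : (2 < size (v :: s))%N by rewrite -es size_rot.
  case: s {es} => [|a [|b s]] //= _ /andP [/= /andP [va]].
  rewrite rcons_path => /andP [_ /andP [_ lv]].
  rewrite edge_relC in lv; have {}lv := nbr _ lv; have {}va := nbr _ va.
  move=> /and3P [_ + _]; rewrite va -lv /=.
  by rewrite mem_last.
Qed.

Lemma tree_extend V E u p : is_tree V E -> u \in V -> path adj u p ->
  exists V' E', [/\ is_tree V' E', V `<=` V' & last u p \in V'].
Proof.
elim: p u V E => [|v p IH] u V E tr uV /=; first by exists V, E.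
move=> /andP [uv pp]; have [vV|vV] := boolP (v \in V); first exact: (IH _ _ _ tr vV pp).
have [|V' [E' [tr' sV' lV']]] := IH v _ _ (tree_leaf tr uV vV uv) _ pp.
  by rewrite !inE eqxx.
by exists V', E'; split=> //; apply: fsubset_trans sV'; apply: fsubsetU1.
Qed.

Lemma joined_by_tree_ex z1 z2 z3 :
  (forall z w, exists2 p, path adj z p & last z p = w) ->
  exists n, joined_by_tree z1 z2 z3 n.
Proof.
move=> con.
have [p pp lp] := con z1 z2; have [q pq lq] := con z1 z3.
have z1V : z1 \in [fset z1] by rewrite in_fset1.
have [V [E [tr sV zV]]] := tree_extend (tree1 z1) z1V pp.
have [V' [E' [tr' sV' zV']]] := tree_extend tr (fsubsetP sV _ z1V) pq.
exists #|` E'|, V', E'; split=> //; split; last by rewrite -lq.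
  exact/(fsubsetP sV')/(fsubsetP sV).
by rewrite -lp; apply: (fsubsetP sV').
Qed.

End Trees.

Definition dinf (z w : int * int) : nat := maxn `|z.1 - w.1|%N `|z.2 - w.2|%N.

Definition adjinf : rel (int * int) := fun z w => dinf z w == 1%N.

Lemma adjinf_connected z w : exists2 p, path adjinf z p & last z p = w.
Proof.
have [n le_n] : exists n, (dinf z w <= n)%N by exists (dinf z w).
have step (a b : int) m : (`|a - b| <= m.+1)%N ->
  exists a', [/\ (`|a - a'| <= 1)%N, (`|a' - b| <= m)%N & a' = a -> a = b].
  move=> ab; exists (if a < b then a + 1 else if b < a then a - 1 else a).
  by case: ltrP => ?; [|case: ltrP => ?]; split; lia.
elim: n z le_n => [|n IH] [a b].
  rewrite leqn0 /dinf /= => /eqP eq0; exists [::] => //=.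
  by case: w eq0 => c d /= eq0; congr (_, _); lia.
rewrite {1}/dinf geq_max /= => /andP [/step [a' [a1 a2 a3]] /step [b' [b1 b2 b3]]].
have [p pp lp] : exists2 p, path adjinf (a', b') p & last (a', b') p = w.
  by apply: IH; rewrite /dinf geq_max a2 b2.
have [eq|ne] := eqVneq (a', b') (a, b).
  by exists p; rewrite -eq.
exists ((a', b') :: p) => //=; rewrite pp andbT /adjinf /dinf /=.
have : a' <> a \/ b' <> b.
  by move: ne; rewrite xpair_eqE negb_and => /orP [] /eqP; [left|right].
lia.
Qed.

Lemma tristance_ex z1 z2 z3 : exists n, `[< joined_by_tree adjinf z1 z2 z3 n >].
Proof.
have [n nP] := joined_by_tree_ex z1 z2 z3 adjinf_connected.
by exists n; apply/asboolP.
Qed.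

Definition tristance (z1 z2 z3 : int * int) : nat :=
  ex_minn (tristance_ex z1 z2 z3).

Definition is_anticode (d : int) (z1 z2 : int * int) (A : set (int * int)) :
    Prop :=
  forall z, A z -> (tristance z1 z2 z)%:Z <= d.

(* Cardinalities are compared by injections, so infinite A need no exclusion. *)
Definition is_optimal_anticode (d : int) (z1 z2 : int * int)
    (A : set (int * int)) : Prop :=
  is_anticode d z1 z2 A /\
  forall B, is_anticode d z1 z2 B -> (B #<= A)%card.

(* Main.v *)
Require Import Defs.
From mathcomp Require Import all_boot all_order all_algebra.
From mathcomp Require Import finmap zify.
From mathcomp Require Import boolp classical_sets cardinality.

(** In the coordinates [u = x + y] ([diag]), [v = x - y] ([antidiag]) every
    edge [e] satisfies [|du e| + |dv e| = 2].  A tree containing [z1, z2, z] has a simple path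
    between any two of them, so the ranges of [u] and of [v] over the three
    points sum to at most twice the number of edges.  Conversely three shortest
    paths from a common vertex [w] form a connected graph; moving the
    coordinatewise median of the points by at most one step to a lattice point
    gives a [w] for which this bound, rounded up, is attained.  Hence
    [tristance z1 z2 z <= d] means that the distances from [u z] and [v z] to
    the intervals [u z1, u z2] and [v z1, v z2] sum to at most [2c], which is
    the stated octagon.  That octagon is the largest anticode, and as it is
    finite it is the only one of its cardinality. *)

Set Implicit Arguments.
Unset Strict Implicit.
Unset Printing Implicit Defensive.

Import Order.TTheory GRing.Theory Num.Theory.

Local Open Scope classical_set_scope.
Local Open Scope ring_scope.

Section Spread.
Variables (T : choiceType) (f : T -> int).

(** An edge carries no order on its endpoints, so the variation of [f] along it is taken as a
    maximum over all pairs. *)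
Definition spread (e : {fset T}) : nat :=
  (\max_(u <- e) \max_(v <- e) `|f u - f v|)%N.

Lemma spread_fset2 u v : spread [fset u; v]%fset = `|f u - f v|%N.
Proof.
have [ue ve] :
    u \in enum_fset [fset u; v]%fset /\ v \in enum_fset [fset u; v]%fset.
  by rewrite !in_fset2 !eqxx orbT.
apply/eqP; rewrite eqn_leq; apply/andP; split.
  apply/bigmax_leqP_seq => a /fset2P ea _.
  apply/bigmax_leqP_seq => b /fset2P eb _.
  by case: ea eb => -> [] ->; lia.
apply: (bigmaxn_sup_seq u ue isT).
exact: (bigmaxn_sup_seq v ve isT).
Qed.

(** Triangle inequality along the path. The induction deletes the first edge from [E]: it cannot be
    used again, since [u] does not recur. *)
Lemma path_spread (E : {fset {fset T}}) u p :
  path (edge_rel E) u p -> uniq (u :: p) ->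
  (`|f u - f (last u p)| <= \sum_(e <- E) spread e)%N.
Proof.
elim: p u E => [|v p IH] u E; first by rewrite /= subrr.
rewrite [path _ _ _]/= => /andP [uv pp] /andP [up up'].
rewrite (big_fsetD1 _ uv) spread_fset2 /=.
suff : (`|f v - f (last v p)|
        <= \sum_(e <- (E `\ [fset u; v])%fset) spread e)%N.
  by move: (\sum_(e <- _) _)%N => m ?; lia.
apply: IH up'.
have allp : all (mem (v :: p)) (v :: p) by exact/allP.
apply: sub_in_path allp pp => a b; rewrite !inE => ap bp ab.
rewrite /edge_rel in_fsetD1; apply/andP; split=> //.
apply: contraNneq up => eab.
have : u \in [fset a; b]%fset by rewrite eab in_fset2 eqxx.
by rewrite in_fset2 inE => /orP [] /eqP ->.
Qed.

Lemma connected_spread V (E : {fset {fset T}}) u v :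
  is_connected V E -> u \in V -> v \in V ->
  (`|f u - f v| <= \sum_(e <- E) spread e)%N.
Proof.
move=> con uV vV; have [p pp <-] := con _ _ uV vV.
by case: (shortenP pp) => q pq uq _; apply: path_spread.
Qed.

End Spread.

Definition diag (z : int * int) : int := z.1 + z.2.
Definition antidiag (z : int * int) : int := z.1 - z.2.

Lemma spread_tree V E p q r s : is_tree adjinf V E ->
  p \in V -> q \in V -> r \in V -> s \in V ->
  (`|diag p - diag q| + `|antidiag r - antidiag s| <= 2 * #|` E|)%N.
Proof.
move=> [_ sub con _] pV qV rV sV.
have := connected_spread diag con pV qV.
have := connected_spread antidiag con rV sV.
suff -> : (2 * #|` E| = \sum_(e <- E) spread diag e +
                        \sum_(e <- E) spread antidiag e)%N by lia.
rewrite -big_split card_fset_sum1 big_distrr /= big_seq [RHS]big_seq.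
apply: eq_bigr => e /sub [a [b [_ _ _ ab ->]]]; rewrite !spread_fset2.
(* This is [|a + b| + |a - b| = 2 * max(|a|, |b|)], with maximum 1. *)
by move: ab; rewrite /adjinf /dinf /diag /antidiag; lia.
Qed.

(** The tree grows leaf by leaf along a walk from [u] to [v]; a move to a vertex already present, or
    no move, costs no edge. *)
Lemma tree_reach V E u v n : is_tree adjinf V E -> u \in V ->
  (dinf u v <= n)%N ->
  exists V' E', [/\ is_tree adjinf V' E', (V `<=` V')%fset, v \in V'
                  & (#|` E'| <= #|` E| + n)%N].
Proof.
have step (a b : int) m : (`|a - b| <= m.+1)%N ->
  exists2 a', (`|a - a'| <= 1)%N & (`|a' - b| <= m)%N.
  move=> ab; exists (if a < b then a + 1 else if b < a then a - 1 else a);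
    by case: ltrP => ?; [|case: ltrP => ?]; lia.
elim: n V E u => [|n IH] V E [a b] tr uV.
  rewrite leqn0 /dinf /= => d0; exists V, E; split=> //; last by lia.
  suff -> : v = (a, b) by [].
  by case: v d0 => x y /= d0; congr (_, _); lia.
rewrite {1}/dinf geq_max /= => /andP [/step [a' a1 a2] /step [b' b1 b2]].
have le_n : (dinf (a', b') v <= n)%N by rewrite /dinf geq_max a2 b2.
have [wV|wV] := boolP ((a', b') \in V).
  have [V' [E' [trE sV vV cE]]] := IH _ _ _ tr wV le_n.
  by exists V', E'; split=> //; rewrite addnS; apply: leqW.
have ww : adjinf (a, b) (a', b').
  rewrite /adjinf /dinf /=.
  have : ~ (a = a' /\ b = b') by move=> [ea eb]; rewrite -ea -eb uV in wV.
  by lia.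
have tr' := tree_leaf tr uV wV ww.
have [|V' [E' [trE sV vV cE]]] := IH _ _ _ tr' _ le_n.
  by rewrite !inE eqxx.
exists V', E'; split=> //.
  by apply: fsubset_trans sV; apply: fsubsetU1.
rewrite (leq_trans cE) // cardfsU1 addnS -addSn leq_add2r.
by rewrite -add1n leq_add2r leq_b1.
Qed.

Lemma tristance_le_star z1 z2 z3 w :
  (tristance z1 z2 z3 <= dinf w z1 + dinf w z2 + dinf w z3)%N.
Proof.
have wV : w \in [fset w]%fset by rewrite in_fset1.
have [V1 [E1 [tr1 s1 m1 c1]]] :=
  tree_reach (tree1 adjinf w) wV (leqnn (dinf w z1)).
have [V2 [E2 [tr2 s2 m2 c2]]] :=
  tree_reach tr1 (fsubsetP s1 _ wV) (leqnn (dinf w z2)).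
have [V3 [E3 [tr3 s3 m3 c3]]] :=
  tree_reach tr2 (fsubsetP s2 _ (fsubsetP s1 _ wV)) (leqnn (dinf w z3)).
rewrite cardfs0 in c1.
rewrite /tristance; case: ex_minnP => n _ /(_ #|` E3|) le_n.
have : (n <= #|` E3|)%N; last by lia.
apply: le_n; apply/asboolP; exists V3, E3; split=> //; split=> //.
  exact/(fsubsetP s3)/(fsubsetP s2).
exact: (fsubsetP s3).
Qed.

Lemma tristance_ge z1 z2 z3 p q r s :
  p \in [:: z1; z2; z3] -> q \in [:: z1; z2; z3] ->
  r \in [:: z1; z2; z3] -> s \in [:: z1; z2; z3] ->
  (`|diag p - diag q| + `|antidiag r - antidiag s|
     <= 2 * tristance z1 z2 z3)%N.
Proof.
rewrite /tristance; case: ex_minnP => n /asboolP [V [E [tr [m1 m2 m3] <-]]] _.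
have mem t : t \in [:: z1; z2; z3] -> t \in V.
  by rewrite !inE => /or3P [] /eqP ->.
by move=> /mem pV /mem qV /mem rV /mem sV; apply: spread_tree tr _ _ _ _.
Qed.

Definition octagon (x1 y1 x2 y2 c : int) : set (int * int) :=
  [set z : int * int | let: (x, y) := z in
     [/\ x1 - c <= x <= x2 + c,
         x1 + y1 - 2 * c <= x + y <= x2 + y2 + 2 * c,
         x1 - y1 - 2 * c <= x - y <= x2 - y2 + 2 * c &
         (x1 + y1) - (x2 - y2) - 2 * c <= 2 * y
           <= (x2 + y2) - (x1 - y1) + 2 * c]].

Lemma finite_octagon x1 y1 x2 y2 c : finite_set (octagon x1 y1 x2 y2 c).
Proof.
have fin (a b : int) : finite_set [set i : int | a <= i <= b].
  apply: (@sub_finite_set _ _ ((fun n : nat => a + n%:Z) @` `I_(`|b - a|.+1))).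
    by move=> i /= ai; exists `|i - a|%N; lia.
  exact/finite_image/finite_II.
pose m := (`|x1| + `|y1| + `|x2| + `|y2| + `|c|)%N%:Z.
apply: sub_finite_set (finite_setX (fin (- (2 * m)) (2 * m))
  (fin (- (2 * m)) (2 * m))) => -[x y] [h1 h2 h3 h4] /=.
by rewrite /m; split; lia.
Qed.

(* The point is [((p + q)/2, (p - q)/2)], where [(p, q)] is the median in the
   coordinates [x + y], [x - y], or a neighbour of it inside the rectangle
   spanned by the first two points when [p + q] is odd. *)
Lemma octagon_star x1 y1 x2 y2 c x y : `|y2 - y1| <= x2 - x1 -> 0 <= c ->
  octagon x1 y1 x2 y2 c (x, y) ->
  exists w, (dinf w (x1, y1) + dinf w (x2, y2) + dinf w (x, y))%N%:Z
              <= x2 - x1 + c.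
Proof.
move=> le12 c0 [h1 h2 h3 h4].
have [p [q [k [pI qI pq pqc]]]] : exists p q k : int,
    [/\ x1 + y1 <= p <= x2 + y2, x1 - y1 <= q <= x2 - y2, p + q = 2 * k
      & `|x + y - p| + `|x - y - q| <= 2 * c].
  pose p := Order.max (x1 + y1) (Order.min (x + y) (x2 + y2)).
  pose q := Order.max (x1 - y1) (Order.min (x - y) (x2 - y2)).
  have pE : p = Order.max (x1 + y1) (Order.min (x + y) (x2 + y2)) by [].
  have qE : q = Order.max (x1 - y1) (Order.min (x - y) (x2 - y2)) by [].
  clearbody p q.
  have [pI qI] : x1 + y1 <= p <= x2 + y2 /\ x1 - y1 <= q <= x2 - y2 by lia.
  (* If one term vanishes, the bounds on [x + y] or [x - y] apply; if neither does, those on [x] or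
     [2 * y]. *)
  have pqc : `|x + y - p| + `|x - y - q| <= 2 * c by lia.
  have [k [pq|pq]] : exists k, p + q = 2 * k \/ p + q = 2 * k + 1.
  - by exists ((p + q) %/ 2)%Z; lia.
  - by exists p, q, k; split.
  (* The sum in [pqc] has the parity of [p + q], so here it is at most [2 * c - 1] and a unit move
     is affordable. If [p] cannot move, then [p = x1 + y1], and parity gives [q > x1 - y1]. *)
  case: (ltrP p (x2 + y2)) => hp; first by exists (p + 1), q, (k + 1); split; lia.
  case: (ltrP (x1 + y1) p) => hp'; first by exists (p - 1), q, k; split; lia.
  by exists p, (q - 1), k; split; lia.
(* The first two distances add up to [x2 - x1], as [p] and [q] lie in their intervals; the third is
   at most [c]. *)
exists (k, p - k); rewrite /dinf /=; lia.
Qed.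

Lemma tristance_octagon x1 y1 x2 y2 d z : `|y2 - y1| <= x2 - x1 <= d ->
  (tristance (x1, y1) (x2, y2) z)%:Z <= d <->
  octagon x1 y1 x2 y2 (d - (x2 - x1)) z.
Proof.
case: z => x y /andP [le12 led]; split; last first.
  have c0 : 0 <= d - (x2 - x1) by lia.
  move=> /(octagon_star le12 c0) [w].
  have := tristance_le_star (x1, y1) (x2, y2) (x, y) w; lia.
set z1 := (x1, y1); set z2 := (x2, y2); set z := (x, y).
have z1s : z1 \in [:: z1; z2; z] by rewrite !inE eqxx.
have z2s : z2 \in [:: z1; z2; z] by rewrite !inE eqxx orbT.
have zs : z \in [:: z1; z2; z] by rewrite !inE eqxx !orbT.
move=> le_d.
(* Choosing the pairs for [diag] and [antidiag] independently gives eight inequalities, one for each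
   side of the octagon. *)
have zz1 := @tristance_ge z1 z2 z _ _ _ _ zs z1s.
have zz2 := @tristance_ge z1 z2 z _ _ _ _ zs z2s.
have z12 := @tristance_ge z1 z2 z _ _ _ _ z2s z1s.
have := (zz1 _ _ z2s z1s, zz1 _ _ zs z1s, zz1 _ _ zs z2s).
have := (zz2 _ _ z2s z1s, zz2 _ _ zs z1s, zz2 _ _ zs z2s).
have := (z12 _ _ zs z1s, z12 _ _ zs z2s).
rewrite /octagon /diag /antidiag /=; move: le_d.
set t := tristance _ _ _; clearbody t; rewrite /z1 /z2 /z /= => le_d.
clear -le12 le_d => -[h1 h2] [[h3 h4] h5] [[h6 h7] h8].
by split; apply/andP; split; lia.
Qed.

Theorem theorem17 (x1 y1 x2 y2 d : int) (A : set (int * int)) :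
  let z1 := (x1, y1) in
  let z2 := (x2, y2) in
  let c := d - (dinf z1 z2)%:Z in
  z1 <> z2 ->
  `|y2 - y1| <= x2 - x1 ->
  (dinf z1 z2)%:Z <= d ->
  is_optimal_anticode d z1 z2 A <->
  A = [set z : int * int | let: (x, y) := z in
         [/\ x1 - c <= x <= x2 + c,
             x1 + y1 - 2 * c <= x + y <= x2 + y2 + 2 * c,
             x1 - y1 - 2 * c <= x - y <= x2 - y2 + 2 * c &
             (x1 + y1) - (x2 - y2) - 2 * c <= 2 * y
               <= (x2 + y2) - (x1 - y1) + 2 * c]].
Proof.
move=> z1 z2 c _ le12 led.
have cE : c = d - (x2 - x1) by rewrite /c /z1 /z2 /dinf /=; lia.
rewrite -/(octagon x1 y1 x2 y2 c) cE; set S := octagon _ _ _ _ _.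
have le12d : `|y2 - y1| <= x2 - x1 <= d.
  by move: le12 led; rewrite /z1 /z2 /dinf /=; lia.
have anti z : (tristance z1 z2 z)%:Z <= d <-> S z := tristance_octagon z le12d.
have finS : finite_set S by apply: finite_octagon.
split=> [[antA maxA]|->].
  have AS : A `<=` S by move=> z /antA /anti.
  have finA : finite_set A := sub_finite_set AS finS.
  (* Optimality of [A] is tested against the anticode [S] itself. *)
  have SA : (S #<= A)%card := maxA S (fun z => (anti z).2).
  apply: fset_set_inj => //; apply/eqP; rewrite eqEfcard.
  have /(fcard_eq finA finS) -> : (A #= S)%card.
    by apply: Cantor_Bernstein SA; apply: subset_card_le.
  by rewrite leqnn andbT -fset_set_sub.
split=> [z /anti //|B antB].
by apply: subset_card_le => z /antB /anti.
Qed.
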